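(* Let $\lambda,\mu$ be strict partitions of the same size $N$. Then $$2^{\ell(\mu)}C_{\lambda\mu}(t,s)=2^{\ell(\lambda)}C_{\mu\lambda}(t,s).$$ Equivalently, if $H_N=\operatorname{diag}\bigl(2^{\ell(\lambda)}:\lambda\in\mathrm{SP}(N)\bigr)$, then $C_N(t,s)H_N$ is a symmetric matrix. Equivalently, after adjoining $\sqrt2$ to the scalars if desired, $H_N^{-1/2}C_N(t,s)H_N^{1/2}$ is symmetric.
   Context: A strict partition is a finite sequence $\lambda=(\lambda_1>\cdots>\lambda_\ell>0)$ of integers, with $|\lambda|=\sum\lambda_i$, $\ell(\lambda)=\ell$; $\mathrm{SP}(N)$ is the set of strict partitions of $N$. Let $\Gamma=\mathbb{Q}[p_1,p_3,p_5,\ldots]$ be the ring of odd power sums, graded by $\deg p_n=n$, with degree-$N$ component $\Gamma_N$. The Schur $Q$-functions $Q_\lambda\in\Gamma$ are defined as follows: $q_r$ is given by $\sum_{r\ge0}q_rz^r=\exp\bigl(2\sum_{n\ge1,\ n\text{ odd}}\frac{p_n}{n}z^n\bigr)$; for $r\ge s\ge0$ let $Q_{(r,s)}=q_rq_s+2\sum_{k=1}^{s}(-1)^kq_{r+k}q_{s-k}$; in general $Q_\lambda$ is the Pfaffian of the antisymmetric matrix with entries $Q_{(\lambda_i,\lambda_j)}$ for $i<j$, where a zero part is appended to $\lambda$ if $\ell(\lambda)$ is odd (so $Q_{(r)}=q_r$, $Q_\varnothing=1$). $\{Q_\lambda:\lambda\in\mathrm{SP}(N)\}$ is a basis of $\Gamma_N$.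 Standard fact from the classical theory of Schur $Q$-functions (Macdonald's book on symmetric functions): for the scalar product $\langle p_\alpha,p_\beta\rangle=2^{-\ell(\alpha)}z_\alpha\delta_{\alpha\beta}$ on $\Gamma$ ($\alpha,\beta$ partitions into odd parts, $p_\alpha=\prod_ip_{\alpha_i}$, $z_\alpha=\prod_r r^{m_r}m_r!$ with $m_r$ the multiplicity of $r$ in $\alpha$), $\langle Q_\lambda,Q_\mu\rangle=2^{\ell(\lambda)}\delta_{\lambda\mu}$. Let $t,s$ be independent indeterminates, with scalars extended to $\mathbb{Q}(t,s)$. Let $T_{t,s}$ be the algebra automorphism of $\Gamma$ (after extension of scalars) with $T_{t,s}(p_n)=\frac{1-t^n}{1-s^n}p_n$ for $n$ odd. Define $C_{\lambda\mu}(t,s)$, for $\lambda,\mu\in\mathrm{SP}(N)$, by $T_{t,s}Q_\lambda=\sum_{\mu\in\mathrm{SP}(N)}C_{\lambda\mu}(t,s)Q_\mu$, and let $C_N(t,s)=(C_{\lambda\mu}(t,s))_{\lambda,\mu\in\mathrm{SP}(N)}$, rows and columns in the same fixed order (also used for $H_N$). *)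

(* Defs.v *)
From HB Require Import structures.
From mathcomp Require Import all_boot all_order all_fingroup all_algebra finmap.
From mathcomp Require Import monalg.

Set Implicit Arguments.
Unset Strict Implicit.
Unset Printing Implicit Defensive.

Import GRing.Theory.
Local Open Scope ring_scope.

Definition is_strict_partition (N : nat) (la : seq nat) : bool :=
  [&& sorted gtn la, all (fun k => 0 < k)%N la & sumn la == N].

Record strict_partition (N : nat) := StrictPartition {
  parts :> seq nat;
  parts_strict : is_strict_partition N parts
}.

HB.instance Definition _ (N : nat) := [isSub for @parts N].
HB.instance Definition _ (N : nat) := [Countable of strict_partition N by <:].

(* Finiteness: at most N parts, each of them at most N. *)
Section StrictPartitionFinite.
Variable N : nat.

Lemma strict_partition_size (la : strict_partition N) : (size la <= N)%N.
Proof.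
case: la => la /= /and3P[_ la_gt0 /eqP <-].
elim: la la_gt0 => //= k la IHla /andP[k_gt0 /IHla le_la].
by rewrite -add1n leq_add.
Qed.

Lemma strict_partition_part (la : strict_partition N) k :
  k \in (la : seq nat) -> (k < N.+1)%N.
Proof.
case: la => la /= /and3P[_ _ /eqP <-]; rewrite ltnS.
elim: la => //= j la IHla; rewrite inE => /predU1P[->|/IHla le_k].
  exact: leq_addr.
exact: leq_trans le_k (leq_addl _ _).
Qed.

Definition strict_partition_code (la : strict_partition N) : N.-bseq 'I_N.+1 :=
  insub_bseq N [seq inord k | k <- la].

Definition strict_partition_decode (s : N.-bseq 'I_N.+1) :
    option (strict_partition N) :=
  insub [seq val i | i <- s].

Lemma strict_partition_codeK :
  pcancel strict_partition_code strict_partition_decode.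
Proof.
move=> la; rewrite /strict_partition_decode /strict_partition_code /insub_bseq.
rewrite insubdK ?unfold_in ?size_map ?strict_partition_size //.
rewrite -map_comp (_ : map _ _ = val la) ?valK //.
rewrite -[RHS]map_id; apply/eq_in_map => k /strict_partition_part lt_k.
by rewrite /= inordK.
Qed.

HB.instance Definition _ :=
  isFinite.Build (strict_partition N) (pcan_enumP strict_partition_codeK).

End StrictPartitionFinite.

(* The i-th indeterminate, i = 0, 1, 2, ..., stands for p_(2i+1). The scalars
   are extended from the rationals to K, of characteristic 0 in all uses. *)
Definition Gamma (K : fieldType) := {malg K[{cmonom nat}]}.
HB.instance Definition _ (K : fieldType) := GRing.ComAlgebra.on (Gamma K).

(* [psum K n] is the power sum p_n; meaningful for odd n only. *)
Definition psum (K : fieldType) (n : nat) : Gamma K :=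
  << (ucm n./2 : {cmonom nat}) >>.

(* Coefficient of z^r in the exponential of the formal power series
   \sum_n (f n) z^n, under the assumption f 0 = 0, so that only the terms with
   n <= r of the series and the powers k <= r contribute. *)
Definition exp_coef (K : fieldType) (A : comAlgType K) (f : nat -> A) (r : nat)
    : A :=
  \sum_(k < r.+1) (k`!%:R : K)^-1 *: ((\poly_(n < r.+1) f n) ^+ k)`_r.

Definition qfun (K : fieldType) (r : nat) : Gamma K :=
  exp_coef (fun n => if odd n then (2 / n%:R : K) *: psum K n else 0) r.

Definition Q2 (K : fieldType) (r s : nat) : Gamma K :=
  qfun K r * qfun K s
  + 2 * \sum_(1 <= k < s.+1) (-1) ^+ k * (qfun K (r + k) * qfun K (s - k)).

Section Pfaffian.
Variable m : nat.

Lemma pf_fst_subproof (i : 'I_m) : (i.*2 < m.*2)%N.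
Proof. by rewrite ltn_double. Qed.

Lemma pf_snd_subproof (i : 'I_m) : (i.*2.+1 < m.*2)%N.
Proof. by rewrite ltn_Sdouble. Qed.

Definition pf_fst (i : 'I_m) : 'I_m.*2 := Ordinal (pf_fst_subproof i).
Definition pf_snd (i : 'I_m) : 'I_m.*2 := Ordinal (pf_snd_subproof i).

Definition pfaffian (K : fieldType) (A : comAlgType K) (M : 'M[A]_m.*2) : A :=
  ((2 ^ m * m`!)%:R : K)^-1 *:
  \sum_(sg : 'S_m.*2)
     (-1) ^+ sg * \prod_(i < m) M (sg (pf_fst i)) (sg (pf_snd i)).

End Pfaffian.

(* The index range has the even size 2 * ceil(l / 2), l the length of la; the
   default value of nth provides the zero part appended when l is odd. *)
Definition Qfun (K : fieldType) (la : seq nat) : Gamma K :=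
  pfaffian (\matrix_(i < (uphalf (size la)).*2, j < (uphalf (size la)).*2)
    if (i < j)%N then Q2 K (nth 0%N la i) (nth 0%N la j)
    else if (j < i)%N then - Q2 K (nth 0%N la j) (nth 0%N la i)
    else 0).

Section DiagonalRescaling.
Variables (K : fieldType) (c : nat -> K).

Definition scale_monom (m : {cmonom nat}) : Gamma K :=
  \prod_(i <- finsupp m) (c i.*2.+1 *: psum K i.*2.+1) ^+ m i.

Lemma scale_monomE (d : {fset nat}) (m : {cmonom nat}) :
    (finsupp m `<=` d)%fset ->
  scale_monom m = \prod_(i <- d) (c i.*2.+1 *: psum K i.*2.+1) ^+ m i.
Proof.
move=> le_md; rewrite /scale_monom (big_fset_incl _ le_md) // => i _.
by rewrite -cmE_neq0 negbK => /eqP ->.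
Qed.

Lemma scale_monom_mmorphism : mmorphism scale_monom.
Proof.
split=> [m1 m2|]; last by rewrite /scale_monom mdom1 big_seq_fset0.
pose d := (finsupp m1 `|` finsupp m2)%fset.
rewrite !(scale_monomE (d := d)) ?fsubsetUl ?fsubsetUr ?mdomD ?fsubset_refl //.
by rewrite -big_split /=; apply: eq_bigr => i _; rewrite cmM exprD.
Qed.

HB.instance Definition _ :=
  isMultiplicative.Build _ _ scale_monom scale_monom_mmorphism.

Definition rescale (g : Gamma K) : Gamma K :=
  mmap (malgC : K -> Gamma K) scale_monom g.

HB.instance Definition _ :=
  GRing.RMorphism.copy rescale (mmap (malgC : K -> Gamma K) scale_monom).

Lemma rescale_is_scalable : scalable rescale.
Proof. by move=> a g; rewrite /rescale mmapZ mul_malgC. Qed.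

HB.instance Definition _ :=
  GRing.isScalable.Build K (Gamma K) (Gamma K) *:%R rescale rescale_is_scalable.

Lemma rescale_psum n : odd n -> rescale (psum K n) = c n *: psum K n.
Proof.
move=> odd_n; rewrite /rescale /psum mmapU mul1r /= /scale_monom.
have n2 : n = n./2.*2.+1 by rewrite -[LHS]odd_double_half odd_n.
by rewrite mdomU big_seq_fset1 cmUU expr1 -n2.
Qed.

End DiagonalRescaling.

(* Q(t, s), as the field of fractions of Q[t][s]: t is the inner variable and s
   the outer one. *)
Definition Qts : fieldType := {fraction {poly {poly rat}}}.
Definition t_ : Qts := tofrac ('X%:P).
Definition s_ : Qts := tofrac 'X.

Definition Tts : Gamma Qts -> Gamma Qts :=
  rescale (fun n => (1 - t_ ^+ n) / (1 - s_ ^+ n)).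

HB.instance Definition _ := GRing.LRMorphism.on Tts.

Lemma Tts_psum n : odd n ->
  Tts (psum Qts n) = ((1 - t_ ^+ n) / (1 - s_ ^+ n)) *: psum Qts n.
Proof. exact: rescale_psum. Qed.

(* e enumerates the strict partitions of N, in an arbitrary order. *)
Definition SPmx (K : fieldType) (N n : nat) (e : 'I_n -> strict_partition N)
    (C : strict_partition N -> strict_partition N -> K) : 'M[K]_n :=
  \matrix_(i, j) C (e i) (e j).

Definition SPdiag (K : fieldType) (N n : nat) (e : 'I_n -> strict_partition N)
    (a : K) : 'M[K]_n :=
  diag_mx (\row_i a ^+ size (e i)).

(* Main.v *)
(* Monomials in the power sums are orthogonal for the scalar product and are
   eigenvectors of T_(t,s), which is therefore self-adjoint; what has to be
   proved is the orthogonality of the Q_la, directly from their Pfaffian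
   definition. Let d_f be the contraction of functions H of a finite sequence,
   (d_f H)(s) = \sum_j (-1)^j f(s_j) H(s minus s_j). Contractions anticommute,
   the Pfaffian P of a kernel a satisfies P(x, s) = (d_(a(x,-)) P)(s), and Q is
   (1 + d_q) P for the kernel Q_(r,s). The homomorphism p_n |-> p_n + u^n, whose
   u^k coefficient is adjoint to multiplication by q_k, sends q to q + h with
   h_r = 2 \sum_(k >= 1) u^k q_(r-k) and adds to the kernel the rank two form
   h /\ q; hence it sends Q to (1 + d_h) Q. Reading this in one way,
   Q_(m,s) = \sum_k (-1)^k q_(m+k) [u^k](1 + d_h) Q_s, and in the adjoint way,
   \sum_k (-1)^k q_k [u^(m+k)](1 + d_h) Q_t
   = 2 \sum_(j : t_j = m) (-1)^j Q_(t minus t_j), because q(z) q(-z) = 1.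
   So <Q_(m,s), Q_t> = 2 \sum_(j : t_j = m) (-1)^j <Q_s, Q_(t minus t_j)>. *)
From HB Require Import structures.
Require Import Defs.
From mathcomp Require Import all_boot all_order all_fingroup all_algebra.
From mathcomp Require Import finmap monalg ring zify.
Set Implicit Arguments.
Unset Strict Implicit.
Unset Printing Implicit Defensive.
Import GRing.Theory.
Local Open Scope ring_scope.

(** * Contractions and Pfaffians *)

Section Contraction.
Variables (A : comPzRingType) (T : Type).
Implicit Types (f g h q : T -> A) (s t : seq T) (H : seq T -> A).

Fixpoint alt_sum (G : T -> seq T -> A) s : A :=
  if s is x :: s' then G x s' - alt_sum (fun y t => G y (x :: t)) s' else 0.

Definition contract f H s := alt_sum (fun x t => f x * H t) s.

Lemma eq_alt_sum (G G' : T -> seq T -> A) s :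
    (forall x t, (size t).+1 = size s -> G x t = G' x t) ->
  alt_sum G s = alt_sum G' s.
Proof.
elim: s G G' => //= x s IHs G G' eqG; rewrite eqG //; congr (_ - _).
by apply: IHs => y t st; apply: eqG; rewrite /= st.
Qed.

Lemma alt_sumD (G G' : T -> seq T -> A) s :
  alt_sum (fun x t => G x t + G' x t) s = alt_sum G s + alt_sum G' s.
Proof.
elim: s G G' => /= [|x s IHs] G G'; first by rewrite addr0.
by rewrite (IHs (fun y t => G y (x :: t))); ring.
Qed.

Lemma alt_sumZ c (G : T -> seq T -> A) s :
  alt_sum (fun x t => c * G x t) s = c * alt_sum G s.
Proof.
elim: s G => /= [|x s IHs] G; first by rewrite mulr0.
by rewrite (IHs (fun y t => G y (x :: t))); ring.
Qed.

Lemma alt_sumN (G : T -> seq T -> A) s :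
  alt_sum (fun x t => - G x t) s = - alt_sum G s.
Proof.
rewrite -mulN1r -alt_sumZ; apply: eq_alt_sum => x t _.
by rewrite mulN1r.
Qed.

Lemma contract_cons f H x s :
  contract f H (x :: s) = f x * H s - contract f (fun t => H (x :: t)) s.
Proof. by []. Qed.

Lemma eq_contractl f g H s : f =1 g -> contract f H s = contract g H s.
Proof. by move=> fg; apply: eq_alt_sum => x t _; rewrite fg. Qed.

Lemma eq_contractr f H H' s :
    (forall t, (size t).+1 = size s -> H t = H' t) ->
  contract f H s = contract f H' s.
Proof. by move=> eqH; apply: eq_alt_sum => x t st; rewrite eqH. Qed.

Lemma contractDl f g H s :
  contract (fun x => f x + g x) H s = contract f H s + contract g H s.
Proof. by rewrite -alt_sumD; apply: eq_alt_sum => x t _; ring. Qed.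

Lemma contractZl c f H s :
  contract (fun x => c * f x) H s = c * contract f H s.
Proof. by rewrite -alt_sumZ; apply: eq_alt_sum => x t _; ring. Qed.

Lemma contractDr f H H' s :
  contract f (fun t => H t + H' t) s = contract f H s + contract f H' s.
Proof. by rewrite -alt_sumD; apply: eq_alt_sum => x t _; ring. Qed.

Lemma contractZr c f H s :
  contract f (fun t => c * H t) s = c * contract f H s.
Proof. by rewrite -alt_sumZ; apply: eq_alt_sum => x t _; ring. Qed.

Lemma contractNr f H s : contract f (fun t => - H t) s = - contract f H s.
Proof. by rewrite -alt_sumN; apply: eq_alt_sum => x t _; ring. Qed.

Lemma contractBr f H H' s :
  contract f (fun t => H t - H' t) s = contract f H s - contract f H' s.
Proof. by rewrite (contractDr f H) contractNr. Qed.

Lemma contract2_cons f g H x s :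
  contract f (contract g H) (x :: s) =
  f x * contract g H s - g x * contract f H s
  + contract f (contract g (fun t => H (x :: t))) s.
Proof.
rewrite contract_cons.
under [X in _ - X = _]eq_contractr do rewrite contract_cons.
rewrite contractBr contractZr; ring.
Qed.

Lemma contract_contract f H s : contract f (contract f H) s = 0.
Proof.
elim: s H => //= x s IHs H.
by rewrite contract2_cons (IHs (fun t => H (x :: t))); ring.
Qed.

Lemma contract_anticomm f g H s :
  contract f (contract g H) s = - contract g (contract f H) s.
Proof.
elim: s H => [|x s IHs] H; first by rewrite /contract /= oppr0.
by rewrite !contract2_cons (IHs (fun t => H (x :: t))); ring.
Qed.

Section Kernel.
Variable a : T -> T -> A.

Fixpoint list_pf_rec n s : A :=
  match n, s with
  | _, [::] => 1
  | n.+1, x :: s' => contract (a x) (list_pf_rec n) s'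
  | 0, _ => 0
  end.

Definition list_pf s := list_pf_rec (size s) s.

Lemma list_pf_recE n s : (size s <= n)%N -> list_pf_rec n s = list_pf s.
Proof.
rewrite /list_pf; have [k] := ubnP (size s).
elim: k n s => // k IHk [|n] [|x s] //=; rewrite !ltnS => le_sk le_sn.
by apply: eq_contractr => t st; rewrite !IHk //; lia.
Qed.

Lemma list_pf_cons x s : list_pf (x :: s) = contract (a x) list_pf s.
Proof.
rewrite {1}/list_pf /=; apply: eq_contractr => t st.
by rewrite list_pf_recE // -st.
Qed.

Lemma list_pf_odd s : odd (size s) -> list_pf s = 0.
Proof.
have [k] := ubnP (size s); elim: k s => // k IHk [|x s] //= le_sk odd_s.
rewrite list_pf_cons (eq_contractr _ (H' := fun t => 0 * 0)); last first.
  move=> t st; rewrite IHk ?mul0r //; first by lia.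
  by move: odd_s; rewrite -st /= negbK.
by rewrite contractZr mul0r.
Qed.

Lemma list_pf_rcons s z :
  list_pf (rcons s z) = contract (fun x => a x z) list_pf s.
Proof.
have [k] := ubnP (size s); elim: k s => // k IHk [|x s] /= le_sk.
  by rewrite list_pf_cons.
rewrite list_pf_cons contract_cons.
under [X in _ = _ - X]eq_contractr do rewrite list_pf_cons.
rewrite contract_anticomm opprK.
have contract_rcons f H t y : contract f H (rcons t y) =
    contract f (fun t => H (rcons t y)) t + (-1) ^+ size t * (f y * H t).
  elim: t H => [|u t IHt] H; first by rewrite /contract /= expr0; ring.
  rewrite /= !contract_cons (IHt (fun t => H (u :: t))) exprS; ring.
rewrite contract_rcons (eq_contractr _
  (H' := contract (fun x => a x z) list_pf)); last first.
  by move=> t st; apply: IHk; lia.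
rewrite addrC; congr (_ + _).
have [|even_s] := boolP (odd (size s)).
  by move/list_pf_odd ->; rewrite !mulr0.
by rewrite -signr_odd (negPf even_s) mul1r.
Qed.

End Kernel.

Lemma list_pf_shift a h q s :
  list_pf (fun x y => a x y + (h x * q y - q x * h y)) s =
  list_pf a s + contract h (contract q (list_pf a)) s.
Proof.
have [k] := ubnP (size s); elim: k s => // k IHk [|x s] /= le_sk.
  by rewrite /contract /= addr0.
rewrite !list_pf_cons contract2_cons.
rewrite (eq_contractr _ (H' := fun t => list_pf a t +
   contract h (contract q (list_pf a)) t)); last first.
  by move=> t st; apply: IHk; lia.
have -> : contract h (contract q (fun t => list_pf a (x :: t))) s =
    contract h (contract q (contract (a x) (list_pf a))) s.
  by do 2![apply: eq_contractr => ? _]; apply: list_pf_cons.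
have -> H : contract (fun y => a x y + (h x * q y - q x * h y)) H s =
    contract (a x) H s + (h x * contract q H s - q x * contract h H s).
  rewrite -mulNr -!contractZl -!contractDl.
  by apply: eq_contractl => y; rewrite mulNr.
rewrite !contractDr contract_contract.
rewrite (contract_anticomm q h) (contract_anticomm (a x) h).
have -> : contract h (contract (a x) (contract q (list_pf a))) s =
    - contract h (contract q (contract (a x) (list_pf a))) s.
  by rewrite -contractNr; apply: eq_contractr => t _; apply: contract_anticomm.
have -> : contract h (contract q (contract q (list_pf a))) s = 0.
  under eq_contractr do rewrite contract_contract -(mulr0 0).
  by rewrite contractZr mul0r.
ring.
Qed.

End Contraction.

Lemma contract0r (A : comPzRingType) (T : Type) (f : T -> A) s :
  contract f (fun=> 0) s = 0.
Proof. by rewrite -[RHS](mul0r (contract f (fun=> 0) s)) -contractZr mul0r. Qed.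

Lemma eq_list_pf (A : comPzRingType) (T : Type) (a b : T -> T -> A) s :
  (forall x y, a x y = b x y) -> list_pf a s = list_pf b s.
Proof.
move=> eqab; have [k] := ubnP (size s); elim: k s => // k IHk [|x s] //= le_sk.
rewrite !list_pf_cons (eq_contractl _ _ (eqab x)).
by apply: eq_contractr => t st; apply: IHk; lia.
Qed.

Section MorphContraction.
Variables (A B : comPzRingType) (phi : {rmorphism A -> B}) (T : Type).

Lemma rmorph_contract (f : T -> A) H s :
  phi (contract f H s) = contract (phi \o f) (phi \o H) s.
Proof.
elim: s H => [|x s IHs] H; first exact: rmorph0.
by rewrite !contract_cons rmorphB rmorphM (IHs (fun t => H (x :: t))).
Qed.

Lemma rmorph_list_pf (a : T -> T -> A) s :
  phi (list_pf a s) = list_pf (fun x y => phi (a x y)) s.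
Proof.
have [k] := ubnP (size s); elim: k s => // k IHk [|x s] /= le_sk.
  exact: rmorph1.
rewrite !list_pf_cons rmorph_contract.
by apply: eq_contractr => t st; apply: IHk; lia.
Qed.

End MorphContraction.

Lemma sum_ord_trunc (V : nmodType) n N (F : nat -> V) : (n <= N)%N ->
  \sum_(i < N) (if (i < n)%N then F i else 0) = \sum_(i < n) F i.
Proof. by move=> le_nN; rewrite (big_ord_widen N F le_nN) [RHS]big_mkcond. Qed.

Lemma sum_lift_perm (V : nmodType) n (F : 'S_n.+1 -> V) :
  \sum_s F s = \sum_j \sum_(t : 'S_n) F (lift_perm ord0 j t).
Proof.
rewrite pair_big /=; pose L (p : 'I_n.+1 * 'S_n) := lift_perm ord0 p.1 p.2.
have L_inj : injective L.
  move=> [i s] [j t] /permP eqL.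
  have eqij : i = j by move: (eqL ord0); rewrite /L !lift_perm_id.
  rewrite -{}eqij in eqL *; congr (_, _); apply/permP => k.
  by have := eqL (lift ord0 k); rewrite /L !lift_perm_lift => /lift_inj.
rewrite (reindex L) //; apply/onW_bij/(inj_card_bij L_inj).
by rewrite card_prod !card_ord !card_Sn factS.
Qed.

Lemma odd_lift_perm0 n (j : 'I_n.+1) (t : 'S_n) :
  lift_perm ord0 j t = odd j (+) t :> bool.
Proof. by rewrite odd_lift_perm. Qed.

Definition pf_sum (A : comPzRingType) m (M : 'M[A]_m.*2) : A :=
  \sum_(sg : 'S_m.*2)
     (-1) ^+ sg * \prod_(i < m) M (sg (pf_fst i)) (sg (pf_snd i)).

Lemma pf_sum_rec (A : comPzRingType) m (M : 'M[A]_m.+1.*2) :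
  pf_sum M = \sum_(a < m.*2.+2) \sum_(b < m.*2.+1)
    (-1) ^+ (a + b) * (M a (lift a b) *
      pf_sum (\matrix_(i, j) M (lift a (lift b i)) (lift a (lift b j)))).
Proof.
rewrite /pf_sum (sum_lift_perm (n := m.*2.+1)); apply: eq_bigr => a _.
rewrite sum_lift_perm; apply: eq_bigr => b _.
rewrite !mulr_sumr; apply: eq_bigr => s _.
rewrite big_ord_recl /=.
have -> : pf_fst (ord0 : 'I_m.+1) = ord0 :> 'I_m.*2.+2 by apply: val_inj.
have -> : pf_snd (ord0 : 'I_m.+1) = lift ord0 ord0 :> 'I_m.*2.+2.
  exact: val_inj.
rewrite lift_perm_lift !lift_perm_id !odd_lift_perm0.
have -> : (-1) ^+ (odd a (+) (odd b (+) s)) = (-1) ^+ (a + b) * (-1) ^+ s :> A.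
  by rewrite !signr_addb !signr_odd exprD mulrA.
rewrite -mulrA; congr (_ * _); rewrite mulrCA; congr (_ * (_ * _)).
apply: eq_bigr => i _; rewrite mxE.
have -> : pf_fst (lift ord0 i) = lift ord0 (lift ord0 (pf_fst i)) :> 'I_m.*2.+2.
  exact: val_inj.
have -> : pf_snd (lift ord0 i) = lift ord0 (lift ord0 (pf_snd i)) :> 'I_m.*2.+2.
  exact: val_inj.
by rewrite !lift_perm_lift.
Qed.

Section ListPfaffian.
Variables (A : comPzRingType).

Definition rem_nth (T : Type) (s : seq T) j := take j s ++ drop j.+1 s.

Lemma size_rem_nth (T : Type) (s : seq T) j :
  (j < size s)%N -> size (rem_nth s j) = (size s).-1.
Proof. by move=> lt_j; rewrite size_cat size_takel ?size_drop; lia. Qed.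

Lemma nth_rem_nth (T : Type) (x0 : T) s j i :
  (j < size s)%N -> nth x0 (rem_nth s j) i = nth x0 s (bump j i).
Proof.
move=> lt_j; rewrite nth_cat (size_takel (ltnW lt_j)) /bump.
case: ltnP => [lt_ij | le_ji]; first by rewrite nth_take // add0n.
by rewrite nth_drop add1n addSn subnKC.
Qed.

Lemma subseq_rem_nth (T : eqType) (s : seq T) j : subseq (rem_nth s j) s.
Proof.
rewrite -[X in subseq _ X](cat_take_drop j s) cat_subseq //.
by rewrite -add1n -drop_drop drop_subseq.
Qed.

Lemma alt_sum_nth (T : Type) (x0 : T) (G : T -> seq T -> A) s :
  alt_sum G s =
  \sum_(0 <= j < size s) (-1) ^+ j * G (nth x0 s j) (rem_nth s j).
Proof.
elim: s G => [|x s IHs] G; first by rewrite big_geq.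
rewrite /= IHs big_nat_recl //= expr0 mul1r /rem_nth /= drop0.
rewrite -sumrN; congr (_ + _); apply: eq_bigr => j _.
by rewrite exprS mulN1r mulNr.
Qed.

Lemma eq_contract_mem (T : eqType) (f g : T -> A) H s :
  {in s, f =1 g} -> contract f H s = contract g H s.
Proof.
case: s => // x s eqfg; rewrite /contract !(alt_sum_nth x).
by apply: eq_big_nat => j /= lt_j; rewrite eqfg ?mem_nth.
Qed.

Lemma list_pf_map (T U : Type) (f : U -> T) (a : T -> T -> A) s :
  list_pf a (map f s) = list_pf (fun x y => a (f x) (f y)) s.
Proof.
have contract_map g H (u : seq U) :
    contract g H (map f u) = contract (g \o f) (H \o map f) u.
  elim: u H => //= x u IHu H; rewrite !contract_cons.
  by rewrite (IHu (fun t => H (f x :: t))).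
have [k] := ubnP (size s); elim: k s => // k IHk [|x s] //= le_sk.
rewrite !list_pf_cons contract_map.
by apply: eq_contractr => t st; apply: IHk; lia.
Qed.

Lemma eq_pairwise_list_pf (T : eqType) (r : rel T) (a b : T -> T -> A) s :
    (forall x y, r x y -> a x y = b x y) -> pairwise r s ->
  list_pf a s = list_pf b s.
Proof.
move=> eqab; have [k] := ubnP (size s); elim: k s => // k IHk [|x s] //= le_sk.
case/andP=> rxs prs; rewrite !list_pf_cons /contract.
rewrite !(alt_sum_nth x); apply: eq_big_nat => j /= lt_js.
congr (_ * (_ * _)); first by apply/eqab/(allP rxs)/mem_nth.
apply: IHk; first by rewrite size_rem_nth //; lia.
exact: subseq_pairwise (subseq_rem_nth s j) prs.
Qed.

Variables (T : Type) (a : T -> T -> A).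
Hypothesis anti_a : forall x y, a y x = - a x y.

Definition contract_kernel (H : seq T -> A) :=
  alt_sum (fun x t => contract (a x) H t).

Lemma contract_kernel_cons H x s :
  contract_kernel H (x :: s) =
  contract (a x) H s *+ 2 + contract_kernel (fun t => H (x :: t)) s.
Proof.
rewrite /contract_kernel /=.
have -> : alt_sum (fun y t => contract (a y) H (x :: t)) s =
    - contract (a x) H s
      - alt_sum (fun y => contract (a y) (fun t => H (x :: t))) s.
  rewrite /(contract _ _ s) -!alt_sumN -alt_sumD.
  by apply: eq_alt_sum => y t _; rewrite contract_cons anti_a mulNr.
rewrite mulr2n; ring.
Qed.

Lemma eq_contract_kernel H H' s :
    (forall t, (size t).+2 = size s -> H t = H' t) ->
  contract_kernel H s = contract_kernel H' s.
Proof.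
move=> eqH; apply: eq_alt_sum => x t st; apply: eq_contractr => u su.
by rewrite eqH // su.
Qed.

Lemma contract_kernelZ c H s :
  contract_kernel (fun t => c * H t) s = c * contract_kernel H s.
Proof. by rewrite -alt_sumZ; apply: eq_alt_sum => x t _; apply: contractZr. Qed.

Lemma contract_kernelB H H' s :
  contract_kernel (fun t => H t - H' t) s =
  contract_kernel H s - contract_kernel H' s.
Proof.
rewrite -alt_sumN -alt_sumD.
by apply: eq_alt_sum => x t _; apply: contractBr.
Qed.

Lemma contract_kernel_contract f H s :
  contract_kernel (contract f H) s = contract f (contract_kernel H) s.
Proof.
elim: s H => // x s IHs H; rewrite contract_kernel_cons contract_cons.
under eq_contract_kernel do rewrite contract_cons.
rewrite contract_kernelB contract_kernelZ (IHs (fun t => H (x :: t))).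
under [X in _ = _ - X]eq_contractr do rewrite contract_kernel_cons mulr2n.
by rewrite !contractDr mulr2n contract_anticomm; ring.
Qed.

Lemma contract_kernel_list_pf s :
  contract_kernel (list_pf a) s = list_pf a s *+ size s.
Proof.
have [k] := ubnP (size s); elim: k s => // k IHk [|x s] //= le_sk.
rewrite contract_kernel_cons; under eq_contract_kernel do rewrite list_pf_cons.
rewrite contract_kernel_contract list_pf_cons.
case: s le_sk => [|y s] le_sk; first by rewrite /contract /= !mul0rn addr0.
have -> : contract (a x) (contract_kernel (list_pf a)) (y :: s) =
    contract (a x) (list_pf a) (y :: s) *+ size s.
  rewrite -mulr_natl -contractZr; apply: eq_contractr => t [st].
  by rewrite mulr_natl -st; apply: IHk; rewrite st ltnW.
by rewrite -mulrnDr.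
Qed.

Lemma pf_sum_list_pf (x0 : T) m s : size s = m.*2 ->
  pf_sum (\matrix_(i < m.*2, j < m.*2) a (nth x0 s i) (nth x0 s j)) =
  list_pf a s *+ (2 ^ m * m`!).
Proof.
elim: m s => [|m IHm] s size_s.
  rewrite (size0nil size_s) /pf_sum (big_pred1 1%g) => [|sg].
    by rewrite big_ord0 odd_perm1 expr0 mulr1.
  by apply/esym/eqP/permP => -[].
rewrite pf_sum_rec; have -> : (2 ^ m.+1 * m.+1`! = size s * (2 ^ m * m`!))%N.
  by rewrite size_s expnS factS; lia.
rewrite mulrnA -contract_kernel_list_pf -mulr_natr mulrC -contract_kernelZ.
rewrite /contract_kernel (alt_sum_nth x0) size_s big_mkord.
apply: eq_bigr => i _; rewrite /contract (alt_sum_nth x0).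
have lt_i : (i < size s)%N by rewrite size_s.
rewrite size_rem_nth // size_s big_mkord mulr_sumr; apply: eq_bigr => j _.
have lt_j : (j < size (rem_nth s i))%N by rewrite size_rem_nth // size_s.
rewrite !mxE !nth_rem_nth // mulrA -exprD; congr (_ * (_ * _)).
rewrite mulr_natl -IHm; last by rewrite !size_rem_nth // size_s.
by congr pf_sum; apply/matrixP => k l; rewrite !mxE !nth_rem_nth.
Qed.
End ListPfaffian.

Lemma pfaffian_list_pf (K : fieldType) (A : comAlgType K) (T : Type) (x0 : T)
    (a : T -> T -> A) m (M : 'M[A]_m.*2) s :
    [pchar K] =i pred0 -> size s = m.*2 ->
    (forall i j : 'I_m.*2, M i j =
       if (i < j)%N then a (nth x0 s i) (nth x0 s j)
       else if (j < i)%N then - a (nth x0 s j) (nth x0 s i) else 0) ->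
  pfaffian M = list_pf a s.
Proof.
move=> /pcharf0P pchar0 size_s entM; pose b (i j : nat) : A :=
  if (i < j)%N then a (nth x0 s i) (nth x0 s j)
  else if (j < i)%N then - a (nth x0 s j) (nth x0 s i) else 0.
have anti_b i j : b j i = - b i j.
  by rewrite /b; case: ltngtP => // _; rewrite ?opprK ?oppr0.
rewrite /pfaffian -/(pf_sum _).
have -> : list_pf a s = list_pf b (iota 0 m.*2).
  rewrite -[s in LHS](mkseq_nth x0) size_s list_pf_map.
  apply/esym/(eq_pairwise_list_pf (r := ltn)) => [i j /= lt_ij|].
    by rewrite /b lt_ij.
  by rewrite -(sorted_pairwise ltn_trans) iota_ltn_sorted.
have -> : M = \matrix_(i < m.*2, j < m.*2)
    b (nth 0%N (iota 0 m.*2) i) (nth 0%N (iota 0 m.*2) j).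
  by apply/matrixP => i j; rewrite mxE !nth_iota // entM.
rewrite pf_sum_list_pf ?size_iota // -scaler_nat scalerA mulVf ?scale1r //.
by rewrite pchar0 muln_eq0 expn_eq0 -lt0n fact_gt0.
Qed.

(** * Formal power series given by their coefficients *)

Section Convolution.
Variable A : comNzRingType.
Implicit Types f g h P q : nat -> A.

Definition conv f g n := \sum_(i < n.+1) f i * g (n - i)%N.

Lemma conv_coef N f g n : (n <= N)%N ->
  conv f g n = ((\poly_(i < N.+1) f i) * (\poly_(i < N.+1) g i))`_n.
Proof.
move=> le_nN; rewrite coefM; apply: eq_bigr => i _.
by rewrite !coef_poly !ltnS (leq_trans (leq_subr _ _)) ?(leq_trans (leq_ord i)).
Qed.

Lemma eq_conv f f' g g' n :
    (forall i, (i <= n)%N -> f i = f' i) ->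
    (forall i, (i <= n)%N -> g i = g' i) ->
  conv f g n = conv f' g' n.
Proof.
move=> eqf eqg; apply: eq_bigr => i _.
by rewrite eqf ?leq_ord // eqg ?leq_subr.
Qed.

Lemma convC f g n : conv f g n = conv g f n.
Proof. by rewrite !(conv_coef _ _ (leqnn n)) mulrC. Qed.

Lemma convA f g h n : conv f (conv g h) n = conv (conv f g) h n.
Proof.
have polyE a b N : \poly_(i < N.+1) conv a b i =
    \poly_(i < N.+1) ((\poly_(i < N.+1) a i) * (\poly_(i < N.+1) b i))`_i.
  apply/polyP => i; rewrite !coef_poly.
  by case: ifP => // lt_i; apply: conv_coef.
have trunc (a : {poly A}) b N k : (k <= N)%N ->
    ((\poly_(i < N.+1) a`_i) * b)`_k = (a * b)`_k.
  move=> le_kN; rewrite !coefM; apply: eq_bigr => i _.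
  by rewrite coef_poly ltnS (leq_trans (leq_ord i)).
rewrite !(conv_coef _ _ (leqnn n)) !polyE mulrC !trunc //.
by rewrite mulrC mulrA.
Qed.

Lemma convDl f g h n : conv (fun i => f i + g i) h n = conv f h n + conv g h n.
Proof. by rewrite -big_split; apply: eq_bigr => i _; rewrite mulrDl. Qed.

Lemma conv_deriv f g n :
  n%:R * conv f g n =
  conv (fun i => i%:R * f i) g n + conv f (fun i => i%:R * g i) n.
Proof.
rewrite -big_split mulr_sumr; apply: eq_bigr => i _ /=.
have -> : n%:R = i%:R + (n - i)%:R :> A by rewrite -natrD subnKC ?leq_ord.
by ring.
Qed.

(* The coefficientwise form of z q'(z) = P(z) q(z), q(0) = 1. *)
Definition log_deriv P q := q 0%N = 1 /\ forall n, n%:R * q n = conv P q n.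

Lemma log_deriv_conv P U q e :
  log_deriv P q -> log_deriv U e ->
  log_deriv (fun n => P n + U n) (conv q e).
Proof.
move=> [q0 Pq] [e0 Ue]; split=> [|n].
  by rewrite /conv big_ord1 q0 e0 mulr1.
rewrite conv_deriv convDl; congr (_ + _).
  by rewrite convA; apply: eq_conv.
transitivity (conv q (conv U e) n); first exact: eq_conv.
by rewrite !convA; apply: eq_conv => // i _; apply: convC.
Qed.

Definition nat_torsion_free := forall n (x : A), n.+1%:R * x = 0 -> x = 0.

Lemma log_deriv_uniq P q e : nat_torsion_free -> P 0%N = 0 ->
  log_deriv P q -> log_deriv P e -> q =1 e.
Proof.
move=> tf P0 [q0 Pq] [e0 Pe] n.
elim: {n}n.+1 {-2}n (ltnSn n) => // k IHk [|n] lt_nk; first by rewrite q0 e0.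
apply/subr0_eq/(tf n); rewrite mulrBr Pq Pe; apply/eqP; rewrite subr_eq0.
apply/eqP; rewrite /conv !(big_ord_recl n.+1) P0 !mul0r; congr (_ + _).
by apply: eq_bigr => i _; rewrite IHk //= /bump; lia.
Qed.

Lemma log_deriv_sign P q :
  log_deriv P q ->
  log_deriv (fun n => (-1) ^+ n * P n) (fun n => (-1) ^+ n * q n).
Proof.
move=> [q0 Pq]; split=> [|n]; first by rewrite q0 expr0 mulr1.
rewrite mulrCA Pq mulr_sumr; apply: eq_bigr => i _.
have -> : (-1) ^+ n = (-1) ^+ i * (-1) ^+ (n - i) :> A.
  by rewrite -exprD subnKC ?leq_ord.
by ring.
Qed.

(* The series on the right is (1 + u z) / (1 - u z). *)
Lemma log_deriv_cayley (u : A) :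
  log_deriv (fun n => if odd n then 2 * u ^+ n else 0)
            (fun n => (n != 0%N).+1%:R * u ^+ n).
Proof.
set U := fun n => _; set e := fun n => (_ : A).
have conv_step n : conv U e n.+2 = 4 * u ^+ n.+2 + u ^+ 2 * conv U e n.
  rewrite /conv (big_ord_recl n.+2) (big_ord_recl n.+1) mulr_sumr addrA.
  congr (_ + _); first by rewrite /U /e /= subn1 /= !exprS; ring.
  apply: eq_bigr => i _; rewrite /U /e /= /bump /= !add1n !subSS /= negbK.
  by case: ifP => _; rewrite ?exprS; ring.
split=> [|n]; first by rewrite /e expr0 mulr1.
have [k] := ubnP n; elim: k n => // k IHk [|[|n]] lt_nk.
- by rewrite /conv big_ord1 /U !mul0r.
- by rewrite /conv !big_ord_recl big_ord0 /U /e /= subnn; ring.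
rewrite conv_step -IHk; last by lia.
by rewrite /e; case: n {lt_nk} => [|n] /=; rewrite !exprS; ring.
Qed.

Definition pair_coef (x : nat -> A) r s : A :=
  x r * x s + 2 * \sum_(1 <= k < s.+1) (-1) ^+ k * (x (r + k)%N * x (s - k)%N).

Lemma pair_coef0 x r : pair_coef x r 0 = x r * x 0%N.
Proof. by rewrite /pair_coef big_geq // mulr0 addr0. Qed.

Lemma pair_coefS x r s :
  pair_coef x r s.+1 =
  x r * x s.+1 - x r.+1 * x s - pair_coef x r.+1 s.
Proof.
rewrite /pair_coef big_nat_recl //= subn1 addn1.
rewrite (eq_bigr (fun k => - ((-1) ^+ k * (x (r.+1 + k)%N * x (s - k)%N)))).
  by rewrite sumrN; ring.
by move=> k _; rewrite addnS subSS exprS addSn; ring.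
Qed.

Lemma pair_coef_shift u (x g : nat -> A) r s :
    x 0%N = 1 -> g 0%N = 1 ->
    (forall n, g n.+1 - x n.+1 = u * (g n + x n)) ->
  pair_coef g r s = pair_coef x r s + (g r * x s - x r * g s).
Proof.
move=> x0 g0 gS; elim: s r => [|s IHs] r.
  by rewrite !pair_coef0 x0 g0; ring.
rewrite !pair_coefS IHs.
have gSE n : g n.+1 = x n.+1 + u * (g n + x n) by rewrite -gS addrC subrK.
by rewrite !gSE; ring.
Qed.

Lemma eq_log_deriv P P' q :
  P =1 P' -> log_deriv P q -> log_deriv P' q.
Proof.
by move=> eqP [q0 Pq]; split=> // n; rewrite Pq; apply: eq_conv.
Qed.

End Convolution.

Section MorphConvolution.
Variables (A B : comNzRingType) (phi : {rmorphism A -> B}).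

Lemma log_deriv_rmorph P q :
  log_deriv P q -> log_deriv (phi \o P) (phi \o q).
Proof.
move=> [q0 Pq]; split=> [|n] /=; first by rewrite q0 rmorph1.
rewrite -(rmorph_nat phi) -rmorphM Pq rmorph_sum.
by apply: eq_bigr => i _; rewrite rmorphM.
Qed.

Lemma rmorph_pair_coef x r s :
  phi (pair_coef x r s) = pair_coef (phi \o x) r s.
Proof.
rewrite rmorphD !rmorphM rmorph_nat rmorph_sum; congr (_ + _ * _).
by apply: eq_bigr => k _; rewrite !rmorphM rmorphXn rmorphN1.
Qed.

End MorphConvolution.

Section Exponential.
Variables (K : fieldType) (A : comAlgType K) (f : nat -> A).
Hypotheses (pchar0 : [pchar K] =i pred0) (f0 : f 0%N = 0).

Let F N := \poly_(n < N.+1) f n.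

Lemma coef_pow_trunc N M r k : (r <= N)%N -> (r <= M)%N ->
  (F N ^+ k)`_r = (F M ^+ k)`_r.
Proof.
elim: k r => [|k IHk] r le_rN le_rM; first by rewrite !expr0.
rewrite !exprS !coefM; apply: eq_bigr => i _; rewrite !coef_poly !ltnS.
rewrite !(leq_trans (leq_ord i)) //.
by rewrite IHk // (leq_trans (leq_subr _ _)).
Qed.

Lemma coef_pow_small N r k : (r < k)%N -> (F N ^+ k)`_r = 0.
Proof.
elim: k r => // k IHk r lt_rk; rewrite exprS coefM big1 // => -[[|i] lt_i] _.
  by rewrite coef_poly f0 mul0r.
by rewrite IHk ?mulr0 //=; lia.
Qed.

Definition exp_trunc N : {poly A} :=
  \sum_(k < N.+1) (k`!%:R : K)^-1%:A *: F N ^+ k.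

Lemma exp_coefE N r : (r <= N)%N -> exp_coef f r = (exp_trunc N)`_r.
Proof.
move=> le_rN; rewrite /exp_coef /exp_trunc coef_sum.
rewrite -(subnKC le_rN) -addSn big_split_ord /= [X in _ + X]big1 => [|i _].
  rewrite addr0; apply: eq_bigr => k _.
  by rewrite coefZ mulr_algl (@coef_pow_trunc (r + (N - r)) r) ?leq_addr.
by rewrite coefZ coef_pow_small ?mulr0 //; lia.
Qed.

Lemma log_deriv_exp : log_deriv (fun n => n%:R * f n) (exp_coef f).
Proof.
split=> [|[|r]].
- by rewrite /exp_coef big_ord1 expr0 coef1 fact0 invr1 scale1r.
- by rewrite /conv big_ord1 !mul0r.
rewrite (@exp_coefE r.+1) // mulr_natl -coef_deriv.
have derivE : (exp_trunc r.+1)^`() =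
    (F r.+1)^`() * (exp_trunc r.+1 - (r.+1`!%:R : K)^-1%:A *: F r.+1 ^+ r.+1).
  rewrite {2}/exp_trunc big_ord_recr /= addrK.
  rewrite /exp_trunc raddf_sum big_ord_recl expr0 /=.
  rewrite derivZ derivC scaler0 add0r.
  rewrite mulr_sumr; apply: eq_bigr => k _.
  rewrite derivZ deriv_exp /= -scaler_nat scalerA -scalerAr; congr (_ *: _).
  rewrite -scalerAl mul1r factS natrM invfM -scaler_nat scalerA.
  by rewrite mulrAC mulVf ?mul1r // ((pcharf0P K).1 pchar0).
rewrite derivE coefM /conv [RHS]big_ord_recl /= !mul0r add0r.
apply: eq_bigr => i _; rewrite coef_deriv coef_poly ltnS ltn_ord mulr_natl.
rewrite coefB coefZ coef_pow_small ?mulr0 ?subr0 /bump /=; last by lia.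
by rewrite add1n subSS (@exp_coefE r.+1) //; lia.
Qed.

End Exponential.

Lemma pfaffian_pair_coef (K : fieldType) (A : comAlgType K) (x : nat -> A) la :
    [pchar K] =i pred0 -> x 0%N = 1 ->
  pfaffian (\matrix_(i < (uphalf (size la)).*2, j < (uphalf (size la)).*2)
    if (i < j)%N then pair_coef x (nth 0%N la i) (nth 0%N la j)
    else if (j < i)%N then - pair_coef x (nth 0%N la j) (nth 0%N la i)
    else 0) =
  list_pf (pair_coef x) la + contract x (list_pf (pair_coef x)) la.
Proof.
move=> pchar0 x0; pose s' := if odd (size la) then rcons la 0%N else la.
have size_s' : size s' = (uphalf (size la)).*2.
  rewrite /s' -[in RHS](odd_double_half (size la)).
  by case: ifP => odd_s; rewrite ?size_rcons; move: odd_s; lia.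
have nth_s' i : nth 0%N s' i = nth 0%N la i.
  rewrite /s'; case: ifP => // _; rewrite nth_rcons.
  by case: ltngtP => // le_i; rewrite nth_default ?le_i ?(ltnW le_i).
rewrite (pfaffian_list_pf (x0 := 0%N) (a := pair_coef x) pchar0 size_s').
  rewrite -(eq_contractl (f := fun y => pair_coef x y 0)) => [|y]; last first.
    by rewrite pair_coef0 x0 mulr1.
  rewrite -list_pf_rcons /s'; case: (boolP (odd (size la))) => odd_s.
    by rewrite (list_pf_odd _ odd_s) add0r.
  by rewrite [X in _ + X]list_pf_odd ?addr0 // size_rcons.
by move=> i j; rewrite mxE !nth_s'.
Qed.

(** * The scalar product and the adjoint of multiplication by q_k *)

Lemma cmonom_ind (I : choiceType) (Pr : {cmonom I} -> Prop) :
    Pr (@mone _) -> (forall i m, Pr m -> Pr (mmul (ucm i) m)) ->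
  forall m, Pr m.
Proof.
move=> P1 PM m; have [k] := ubnP (mdeg m); elim: k m => // k IHk m lt_mk.
have [-> //|m_neq1] := eqVneq m (@mone _).
have /fset0Pn[i i_m] : finsupp m != fset0.
  apply: contraNneq m_neq1 => m0; apply/cmP => i.
  by apply/eqP; rewrite cm1 cmE_eq0 m0.
have mi_gt0 : (0 < m i)%N by rewrite lt0n cmE_neq0.
have defm : m = mmul (ucm i) (divcm m (ucm i)).
  by apply/eqP/cmP => j; rewrite cmM divcmE ucmE; case: eqP => [<-|] /=; lia.
rewrite defm; apply/PM/IHk; move: lt_mk.
by rewrite {1}defm mdegM mdegU; lia.
Qed.

Section MonomialWeight.
Variable K : fieldType.
Implicit Types m : {cmonom nat}.

Definition mweight m : K :=
  \prod_(i <- finsupp m) ((i.*2.+1%:R / 2) ^+ m i * (m i)`!%:R).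

Lemma mweightE (d : {fset nat}) m : (finsupp m `<=` d)%fset ->
  mweight m = \prod_(i <- d) ((i.*2.+1%:R / 2) ^+ m i * (m i)`!%:R).
Proof.
move=> le_md; rewrite /mweight (big_fset_incl _ le_md) // => i _.
by rewrite -cmE_neq0 negbK => /eqP ->; rewrite expr0 fact0 mulr1.
Qed.

Lemma mweight1 : mweight (@mone _) = 1.
Proof. by rewrite /mweight mdom1 big_seq_fset0. Qed.

Lemma mweightU i m :
  mweight (mmul (ucm i) m) = (i.*2.+1%:R / 2) * (m i).+1%:R * mweight m.
Proof.
pose d := (i |` finsupp m)%fset.
have i_d : i \in d by rewrite !inE eqxx.
rewrite !(mweightE (d := d)) ?mdomD ?mdomU ?fsubset_refl ?fsubsetUr //.
rewrite !(big_fsetD1 i i_d) /= cmM ucmE eqxx add1n exprS factS natrM.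
have -> : \prod_(j <- (d `\ i)%fset)
      ((j.*2.+1%:R / 2) ^+ mmul (ucm i) m j * (mmul (ucm i) m j)`!%:R) =
    \prod_(j <- (d `\ i)%fset) ((j.*2.+1%:R / 2) ^+ m j * (m j)`!%:R) :> K.
  apply: eq_big_seq => j; rewrite in_fsetD1.
  by case/andP=> ne_ji _; rewrite cmM ucmE eq_sym (negPf ne_ji).
by rewrite -!mulrA; congr (_ * (_ * _)); rewrite mulrCA.
Qed.

End MonomialWeight.

(* An abstract copy of Gamma: conversion on {malg K[_]} unfolds its operations
   and makes rewriting intractable, so only the universal property is used. *)
Section GradedAlgebra.
Variables (K : fieldType) (A : comAlgType K) (mon : {cmonom nat} -> A).
Variable ext : forall S : nzRingType,
  {rmorphism K -> S} -> ({cmonom nat} -> S) -> {additive A -> S}.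
Hypothesis pchar0 : [pchar K] =i pred0.
Hypothesis mon1 : mon (@mone _) = 1.
Hypothesis monM : forall m1 m2, mon (mmul m1 m2) = mon m1 * mon m2.
Hypothesis mon_ind : forall Pr : A -> Prop, Pr 0 ->
  (forall f g, Pr f -> Pr g -> Pr (f + g)) ->
  (forall c m, Pr (c *: mon m)) -> forall f, Pr f.
Hypothesis ext_mon : forall (S : nzRingType) (phi : {rmorphism K -> S}) h c m,
  ext phi h (c *: mon m) = phi c * h m.
Implicit Types (f g : A) (m : {cmonom nat}).

Definition power_sum n : A := mon (ucm n./2).
Local Notation p := power_sum.

Let natK_neq0 n : n.+1%:R != 0 :> K.
Proof. by rewrite ((pcharf0P K).1 pchar0). Qed.

Lemma power_sum_monom n m : p n * mon m = mon (mmul (ucm n./2) m).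
Proof. by rewrite monM. Qed.

Lemma power_sum_ind (Pr : A -> Prop) :
    Pr 0 -> (forall f g, Pr f -> Pr g -> Pr (f + g)) ->
    (forall c f, Pr f -> Pr (c *: f)) -> Pr 1 ->
    (forall n f, odd n -> Pr f -> Pr (p n * f)) ->
  forall f, Pr f.
Proof.
move=> P0 PD PZ P1 PM; apply: mon_ind => // c m; apply: PZ.
elim/cmonom_ind: m => [|i m IHm]; first by rewrite mon1.
have odd_n : odd i.*2.+1 by rewrite /= odd_double.
by have := PM _ _ odd_n IHm; rewrite power_sum_monom /= uphalf_double.
Qed.

Lemma nat_torsion_free_alg : nat_torsion_free A.
Proof.
move=> n x; rewrite mulr_natl -scaler_nat => nx0.
by rewrite -[x]scale1r -(mulVf (natK_neq0 n)) -scalerA nx0 scaler0.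
Qed.

Lemma nat_torsion_free_poly (R : comNzRingType) :
  nat_torsion_free R -> nat_torsion_free {poly R}.
Proof.
move=> tf n x nx0; apply/polyP => i; rewrite coef0; apply: (tf n).
by rewrite mulr_natl -coefMn -mulr_natl nx0 coef0.
Qed.

Lemma extZ (S : nzRingType) (phi : {rmorphism K -> S}) h c f :
  ext phi h (c *: f) = phi c * ext phi h f.
Proof.
elim/mon_ind: f => [|f g IHf IHg|d m]; first by rewrite scaler0 !raddf0 mulr0.
  by rewrite scalerDr !raddfD IHf IHg mulrDr.
by rewrite scalerA !ext_mon rmorphM mulrA.
Qed.

Definition coef_mon m f : K := ext idfun (fun m' => (m' == m)%:R) f.

Definition form f g : K := ext idfun (fun m => coef_mon m g * mweight K m) f.

Lemma formDl f1 f2 g : form (f1 + f2) g = form f1 g + form f2 g.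
Proof. exact: raddfD. Qed.

Lemma formZl c f g : form (c *: f) g = c * form f g.
Proof. exact: extZ. Qed.

Lemma form0l g : form 0 g = 0.
Proof. exact: raddf0. Qed.

Lemma form_monl m g : form (mon m) g = coef_mon m g * mweight K m.
Proof.
by rewrite -[mon m]scale1r formZl mul1r -[mon m]scale1r /form ext_mon mul1r.
Qed.

Lemma form_mon m1 m2 : form (mon m1) (mon m2) = (m1 == m2)%:R * mweight K m1.
Proof.
rewrite form_monl -[mon m2]scale1r /coef_mon ext_mon mul1r.
by rewrite eq_sym.
Qed.

Lemma formDr f g1 g2 : form f (g1 + g2) = form f g1 + form f g2.
Proof.
elim/mon_ind: f => [|f1 f2 IH1 IH2|c m]; first by rewrite !form0l addr0.
  by rewrite !formDl IH1 IH2 addrACA.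
by rewrite !formZl !form_monl /coef_mon raddfD mulrDl mulrDr.
Qed.

Lemma formZr c f g : form f (c *: g) = c * form f g.
Proof.
elim/mon_ind: f => [|f1 f2 IH1 IH2|d m]; first by rewrite !form0l mulr0.
  by rewrite !formDl IH1 IH2 mulrDr.
by rewrite !formZl !form_monl /coef_mon extZ /=; ring.
Qed.

Lemma form0r f : form f 0 = 0.
Proof. by rewrite -[0 in LHS](scale0r (0 : A)) formZr mul0r. Qed.

Lemma formC f g : form f g = form g f.
Proof.
elim/mon_ind: f => [|f1 f2 IH1 IH2|c m]; first by rewrite form0l form0r.
  by rewrite formDl formDr IH1 IH2.
elim/mon_ind: g => [|g1 g2 IH1 IH2|d m']; first by rewrite form0l form0r.
  by rewrite formDl formDr IH1 IH2.
rewrite !formZl !formZr !form_mon mulrCA [m' == m]eq_sym.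
by case: eqP => [->//|_]; rewrite !mul0r.
Qed.

Lemma form_suml (I : Type) (r : seq I) (P : pred I) (F : I -> A) g :
  form (\sum_(i <- r | P i) F i) g = \sum_(i <- r | P i) form (F i) g.
Proof.
by elim/big_rec2: _ => [|i x y _ <-]; rewrite ?form0l ?formDl.
Qed.

Lemma form_sumr (I : Type) (r : seq I) (P : pred I) f (F : I -> A) :
  form f (\sum_(i <- r | P i) F i) = \sum_(i <- r | P i) form f (F i).
Proof. by rewrite formC form_suml; apply: eq_bigr => i _; apply: formC. Qed.

Lemma form1 : form 1 1 = 1.
Proof. by rewrite -mon1 form_mon eqxx mweight1 mulr1. Qed.

Definition pderiv i f : A :=
  ext (in_alg A) (fun m => (m i)%:R * mon (divcm m (ucm i))) f.

Lemma pderivD i f g : pderiv i (f + g) = pderiv i f + pderiv i g.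
Proof. exact: raddfD. Qed.

Lemma pderiv0 i : pderiv i 0 = 0.
Proof. exact: raddf0. Qed.

Lemma pderiv_mon i c m :
  pderiv i (c *: mon m) = (c * (m i)%:R) *: mon (divcm m (ucm i)).
Proof.
by rewrite /pderiv ext_mon /= mulr_algl -scalerA scaler_nat mulr_natl.
Qed.

Lemma pderivM i f g : pderiv i (f * g) = pderiv i f * g + f * pderiv i g.
Proof.
elim/mon_ind: f => [|f1 f2 IH1 IH2|c m].
- by rewrite !(mul0r, pderiv0) addr0.
- by rewrite mulrDl !pderivD IH1 IH2 !mulrDl addrACA.
elim/mon_ind: g => [|g1 g2 IH1 IH2|d m'].
- by rewrite !(mulr0, pderiv0) addr0.
- by rewrite mulrDr !pderivD IH1 IH2 !mulrDr addrACA.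
have mulZ a b k l : (a *: mon k) * (b *: mon l) = (a * b) *: mon (mmul k l).
  by rewrite -scalerAl -scalerAr scalerA monM.
rewrite mulZ !pderiv_mon !mulZ cmM natrD.
have divl (k l : {cmonom nat}) : (0 < k i)%N ->
    mmul (divcm k (ucm i)) l = divcm (mmul k l) (ucm i).
  move=> k_gt0; apply/eqP/cmP => j; rewrite divcmE !cmM divcmE ucmE.
  by case: eqP => [<-|_]; rewrite ?subn0 // addnBAC.
have scale_div a (k l : {cmonom nat}) :
    (a * (k i)%:R) *: mon (mmul (divcm k (ucm i)) l) =
    (a * (k i)%:R) *: mon (divcm (mmul k l) (ucm i)).
  have [k0|/divl -> //] := posnP (k i).
  by rewrite k0 mulr0 !scale0r.
rewrite [mmul m (divcm _ _)]mulmC [_ * (m i)%:R * d]mulrAC scale_div.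
by rewrite [c * (d * _)]mulrA scale_div [mmul m' m]mulmC -scalerDl mulrDr.
Qed.

Lemma pderiv1 i : pderiv i 1 = 0.
Proof. by rewrite -[1]scale1r -mon1 pderiv_mon cm1 mulr0 scale0r. Qed.

Lemma pderiv_power_sum i n : pderiv i (p n) = (i == n./2)%:R.
Proof.
rewrite -[p n]scale1r pderiv_mon ucmE mul1r eq_sym.
case: eqP => [->|_]; last by rewrite scale0r.
rewrite scale1r -mon1; congr mon; apply/eqP/cmP => j.
by rewrite divcmE subnn cm1.
Qed.

Lemma form_power_sum n f g : odd n ->
  form (p n * f) g = n%:R / 2 * form f (pderiv n./2 g).
Proof.
move=> odd_n; elim/mon_ind: f => [|f1 f2 IH1 IH2|c m].
- by rewrite mulr0 !form0l mulr0.
- by rewrite mulrDr !formDl IH1 IH2 mulrDr.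
elim/mon_ind: g => [|g1 g2 IH1 IH2|d m'].
- by rewrite pderiv0 !form0r mulr0.
- by rewrite pderivD !formDr IH1 IH2 mulrDr.
rewrite -scalerAr power_sum_monom // pderiv_mon !formZl !formZr !form_mon.
have defn : (n./2.*2.+1 = n)%N by have := odd_double_half n; rewrite odd_n.
rewrite mweightU defn.
have [m'0|m'_gt0] := posnP (m' n./2).
  rewrite m'0 mulr0 mul0r !mulr0 (_ : _ == _ = false) ?mul0r ?mulr0 //.
  by apply/eqP => mm'; move: m'0; rewrite -mm' cmM ucmE eqxx.
have eqmm' : (mmul (ucm n./2) m == m') = (m == divcm m' (ucm n./2)).
  apply/cmP/cmP => eqm i; have := eqm i; rewrite cmM divcmE ucmE.
    by move=> <-; rewrite addKn.
  by move=> ->; rewrite subnKC //; case: eqP => // <-.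
rewrite eqmm'; case: eqP => [->|]; last by rewrite !(mul0r, mulr0).
by rewrite divcmE ucmE eqxx /= subn1 prednK //; ring.
Qed.

Lemma form_adj (T : {lrmorphism A -> A}) (c : nat -> K) :
    (forall n, odd n -> T (p n) = c n *: p n) ->
  forall f g, form (T f) g = form f (T g).
Proof.
move=> Tp; have Tmon m : exists a, T (mon m) = a *: mon m.
  elim/cmonom_ind: m => [|i m [a IHm]].
    by exists 1; rewrite mon1 rmorph1 scale1r.
  have odd_n : odd i.*2.+1 by rewrite /= odd_double.
  exists (c i.*2.+1 * a).
  have -> : mon (mmul (ucm i) m) = p i.*2.+1 * mon m.
    by rewrite power_sum_monom /= uphalf_double.
  by rewrite rmorphM /= Tp // IHm -scalerAl -scalerAr scalerA.
elim/mon_ind => [|f1 f2 IH1 IH2|b m] g; first by rewrite raddf0 !form0l.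
  by rewrite raddfD !formDl IH1 IH2.
elim/mon_ind: g => [|g1 g2 IH1 IH2|d m']; first by rewrite raddf0 !form0r.
  by rewrite raddfD !formDr IH1 IH2.
rewrite !linearZ /= !formZl !formZr; case: (eqVneq m m') => [<-|ne_mm'].
  by have [a ->] := Tmon m; rewrite formZl formZr.
have [[a ->] [a' ->]] := (Tmon m, Tmon m').
by rewrite formZl formZr form_mon (negPf ne_mm') !(mul0r, mulr0).
Qed.

Lemma pderivZ i c f : pderiv i (c *: f) = c *: pderiv i f.
Proof. by rewrite /pderiv extZ /= mulr_algl. Qed.

Lemma form_natl n f g : form (n%:R * f) g = n%:R * form f g.
Proof. by rewrite mulr_natl -scaler_nat formZl. Qed.

Lemma form_natr n f g : form f (n%:R * g) = n%:R * form f g.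
Proof. by rewrite formC form_natl formC. Qed.

Definition shift_monom m : {poly A} :=
  \prod_(i <- finsupp m) ((p i.*2.+1)%:P + 'X^(i.*2.+1)) ^+ m i.

Lemma shift_monomU i m :
  shift_monom (mmul (ucm i) m) =
  ((p i.*2.+1)%:P + 'X^(i.*2.+1)) * shift_monom m.
Proof.
pose d := (i |` finsupp m)%fset.
have i_d : i \in d by rewrite !inE eqxx.
have shiftE (m' : {cmonom nat}) : (finsupp m' `<=` d)%fset -> shift_monom m' =
    \prod_(j <- d) ((p j.*2.+1)%:P + 'X^(j.*2.+1)) ^+ m' j.
  move=> le_md; rewrite /shift_monom (big_fset_incl _ le_md) // => j _.
  by rewrite -cmE_neq0 negbK => /eqP ->; rewrite expr0.
rewrite !shiftE ?mdomD ?mdomU ?fsubset_refl ?fsubsetUr //.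
rewrite !(big_fsetD1 i i_d) /= cmM ucmE eqxx add1n exprS -mulrA.
congr (_ * (_ * _)); apply: eq_big_seq => j; rewrite in_fsetD1.
by case/andP=> ne_ji _; rewrite cmM ucmE eq_sym (negPf ne_ji).
Qed.

Definition shift f : {poly A} := ext (polyC \o in_alg A) shift_monom f.

Lemma shiftD f g : shift (f + g) = shift f + shift g.
Proof. exact: raddfD. Qed.

Lemma shiftZ c f : shift (c *: f) = c%:A%:P * shift f.
Proof. exact: extZ. Qed.

Lemma shift_mon m : shift (mon m) = shift_monom m.
Proof. by rewrite -[mon m]scale1r /shift ext_mon rmorph1 mul1r. Qed.

Lemma shift1 : shift 1 = 1.
Proof. by rewrite -mon1 shift_mon /shift_monom mdom1 big_seq_fset0. Qed.

Lemma shift_power_sumM n f :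
  odd n -> shift (p n * f) = ((p n)%:P + 'X^n) * shift f.
Proof.
move=> odd_n; elim/mon_ind: f => [|f g IHf IHg|c m].
- by rewrite mulr0 /shift raddf0 mulr0.
- by rewrite mulrDr !shiftD IHf IHg mulrDr.
rewrite -scalerAr power_sum_monom !shiftZ mulrCA !shift_mon shift_monomU.
by have := odd_double_half n; rewrite odd_n add1n => ->.
Qed.

Lemma shift_power_sum n : odd n -> shift (p n) = (p n)%:P + 'X^n.
Proof.
by move=> odd_n; rewrite -[p n in LHS]mulr1 shift_power_sumM // shift1 mulr1.
Qed.

Lemma shiftM f g : shift (f * g) = shift f * shift g.
Proof.
elim/power_sum_ind: f => [|f1 f2 IH1 IH2|c f IHf||n f odd_n IHf].
- by rewrite mul0r /shift raddf0 mul0r.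
- by rewrite mulrDl !shiftD IH1 IH2 mulrDl.
- by rewrite -scalerAl !shiftZ IHf mulrA.
- by rewrite shift1 !mul1r.
by rewrite -mulrA !shift_power_sumM // IHf mulrA.
Qed.

Lemma shift_is_zmod_morphism : zmod_morphism shift.
Proof. by move=> f g; rewrite /shift raddfB. Qed.

Lemma shift_is_monoid_morphism : monoid_morphism shift.
Proof. by split; [apply: shift1 | apply: shiftM]. Qed.

HB.instance Definition _ :=
  GRing.isZmodMorphism.Build A {poly A} shift shift_is_zmod_morphism.
HB.instance Definition _ :=
  GRing.isMonoidMorphism.Build A {poly A} shift shift_is_monoid_morphism.

Lemma shift_coef0 f : (shift f)`_0 = f.
Proof.
elim/power_sum_ind: f => [|f1 f2 IH1 IH2|c f IHf||n f odd_n IHf].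
- by rewrite raddf0 coef0.
- by rewrite raddfD coefD IH1 IH2.
- by rewrite shiftZ coefCM IHf mulr_algl.
- by rewrite shift1 coef1.
rewrite shift_power_sumM // coef0M IHf coefD coefC coefXn.
by case: n odd_n => // n _; rewrite addr0.
Qed.

Lemma shift_chain f : exists N0, forall N, (N0 <= N)%N ->
  'X * (shift f)^`() =
  \sum_(n < N | odd n) n%:R * 'X^n * shift (pderiv n./2 f).
Proof.
elim/power_sum_ind: f =>
  [|f g [Nf IHf] [Ng IHg]|c f [Nf IHf]||k f odd_k [Nf IHf]].
- exists 0%N => N _; rewrite raddf0 deriv0 mulr0 big1 // => n _.
  by rewrite pderiv0 raddf0 mulr0.
- exists (maxn Nf Ng) => N; rewrite geq_max => /andP[leN leN'].
  rewrite raddfD derivD mulrDr (IHf N) // (IHg N) // -big_split.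
  by apply: eq_bigr => n _; rewrite pderivD raddfD mulrDr.
- exists Nf => N leN; rewrite shiftZ deriv_mulC mulrCA (IHf N) // mulr_sumr.
  by apply: eq_bigr => n _; rewrite pderivZ shiftZ mulrCA.
- exists 0%N => N _; rewrite shift1 derivC mulr0 big1 // => n _.
  by rewrite pderiv1 raddf0 mulr0.
exists (maxn Nf k.+1) => N; rewrite geq_max => /andP[leN lt_kN].
rewrite shift_power_sumM // derivM derivD derivC add0r derivXn.
have -> : \sum_(n < N | odd n) n%:R * 'X^n * shift (pderiv n./2 (p k * f)) =
    k%:R * 'X^k * shift f + ((p k)%:P + 'X^k) *
      \sum_(n < N | odd n) n%:R * 'X^n * shift (pderiv n./2 f).
  rewrite mulr_sumr (bigD1 (Ordinal lt_kN)) //=.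
  rewrite [in RHS](bigD1 (Ordinal lt_kN)) //=.
  rewrite pderivM pderiv_power_sum eqxx mul1r shiftD shift_power_sumM //.
  rewrite mulrDr -addrA; congr (_ + (_ + _)).
    by rewrite mulrCA.
  apply: eq_bigr => n /andP[odd_n ne_nk].
  rewrite pderivM pderiv_power_sum (_ : _ == _ = false) ?mul0r ?add0r.
    by rewrite shift_power_sumM // mulrCA.
  apply: contraNF ne_nk => /eqP eq_half; apply/eqP/val_inj => /=.
  by rewrite -[LHS]odd_double_half -[RHS]odd_double_half odd_n odd_k eq_half.
rewrite -(IHf N) // mulrDr; congr (_ + _); last by rewrite mulrCA.
by rewrite mulrnAl mulrnAr mulrA -exprS prednK ?mulr_natl ?mulrnAl ?odd_gt0.
Qed.

Lemma shift_coef_chain f k :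
  k%:R * (shift f)`_k =
  \sum_(i < k.+1 | odd i) i%:R * (shift (pderiv i./2 f))`_(k - i).
Proof.
have [N0 chain] := shift_chain f.
have -> : k%:R * (shift f)`_k = ('X * (shift f)^`())`_k.
  rewrite coefXM; case: k => [|k] /=; first by rewrite mul0r.
  by rewrite coef_deriv mulr_natl.
rewrite (chain (maxn N0 k.+1)) ?leq_maxl // coef_sum.
rewrite (big_ord_widen_cond _ (fun i => odd i) (fun i =>
  i%:R * (shift (pderiv i./2 f))`_(k - i)) (leq_maxr N0 k.+1)).
rewrite [LHS](bigID (fun i : 'I__ => (i < k.+1)%N)) /= [X in _ + X]big1.
  rewrite addr0; apply: eq_bigr => i /andP[_ le_ik].
  by rewrite -mulrA mulr_natl coefMn coefXnM ltnNge -ltnS le_ik mulr_natl.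
move=> i /andP[_ le_ik].
by rewrite -mulrA mulr_natl coefMn coefXnM ltnNge -ltnS (negPf le_ik) mul0rn.
Qed.

Definition qcoef r : A :=
  exp_coef (fun n => if odd n then (2 / n%:R : K) *: p n else 0) r.

Definition qlog n : A := if odd n then 2 * p n else 0.

Lemma log_deriv_qcoef : log_deriv qlog qcoef.
Proof.
apply: (eq_log_deriv _ (log_deriv_exp pchar0 _)) => // n.
rewrite /qlog; case: ifP => odd_n; last by rewrite mulr0.
case: n odd_n => // n _.
rewrite mulr_natl -scaler_nat scalerA mulrCA divff ?natK_neq0 // mulr1.
by rewrite scaler_nat mulr_natl.
Qed.

Lemma qcoef0 : qcoef 0 = 1.
Proof. by case: log_deriv_qcoef. Qed.

Lemma qcoef_alternating n :
  \sum_(k < n.+1) (-1) ^+ k * (qcoef k * qcoef (n - k)) = (n == 0%N)%:R.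
Proof.
have log_q := log_deriv_qcoef.
have log_qq := log_deriv_conv (log_deriv_sign log_q) log_q.
have log_one : log_deriv (fun n => (-1) ^+ n * qlog n + qlog n)
    (fun n => (n == 0%N)%:R : A).
  split=> // k; rewrite /conv big1 => [|i _].
    by case: k => [|k]; rewrite ?mul0r ?mulr0.
  rewrite /qlog -signr_odd; case: (odd i); last by rewrite mulr0 addr0 mul0r.
  by rewrite expr1 mulN1r addNr mul0r.
have := log_deriv_uniq nat_torsion_free_alg _ log_qq log_one.
rewrite /qlog /= mulr0 addr0 => /(_ erefl n) <-.
by apply: eq_bigr => k _; rewrite mulrA.
Qed.

Lemma form_qcoef k f g : form (qcoef k * f) g = form f (shift g)`_k.
Proof.
have [n] := ubnP k; elim: n => // n IHn in k f g *; case: k => [|k] lt_kn.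
  by rewrite qcoef0 mul1r shift_coef0.
apply: (mulfI (natK_neq0 k)); rewrite -form_natl mulrA.
have [_ ->] := log_deriv_qcoef; rewrite -form_natr shift_coef_chain.
rewrite /conv mulr_suml form_suml form_sumr [RHS]big_mkcond.
apply: eq_bigr => i _; rewrite /qlog.
case: ifP => odd_i; last by rewrite !mul0r form0l.
have i_gt0 : (0 < i)%N by case: (i : nat) odd_i.
rewrite -!mulrA form_natl form_natr form_power_sum // IHn; last by lia.
by rewrite mulrA mulrCA divff ?mulr1 // (natK_neq0 1).
Qed.

Local Notation cayley := (fun n => (n != 0%N).+1%:R * 'X^n : {poly A}).

Lemma shift_qcoef_conv n :
  shift (qcoef n) = conv (fun n => (qcoef n)%:P) cayley n.
Proof.
have log_q := log_deriv_rmorph shift log_deriv_qcoef.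
have log_qc := log_deriv_conv (log_deriv_rmorph polyC log_deriv_qcoef)
  (log_deriv_cayley ('X : {poly A})).
apply: (log_deriv_uniq (nat_torsion_free_poly nat_torsion_free_alg) _ log_q).
  by rewrite /= rmorph0.
apply: eq_log_deriv log_qc => k /=; rewrite /qlog.
case: ifP => [odd_k|_]; last by rewrite !rmorph0 addr0.
by rewrite !rmorphM /= shift_power_sum // !rmorph_nat mulrDr.
Qed.

Definition qdiff n : {poly A} := shift (qcoef n) - (qcoef n)%:P.

Lemma coef_shift_qcoef n k : (shift (qcoef n))`_k =
  if (k <= n)%N then (k != 0%N).+1%:R * qcoef (n - k) else 0.
Proof.
rewrite shift_qcoef_conv convC coef_sum.
have term (i : 'I_n.+1) : (cayley i * (qcoef (n - i))%:P)`_k =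
    if i == k :> nat then (i != 0%N :> nat).+1%:R * qcoef (n - i) else 0.
  rewrite coefMC mulr_natl coefMn coefXn eq_sym.
  by case: eqP => _; rewrite ?mul0rn ?mul0r // mulr_natl.
under eq_bigr do rewrite term.
case: leqP => [le_kn|lt_nk].
  rewrite (bigD1 (Ordinal (le_kn : k < n.+1)%N)) //= eqxx big1 ?addr0 // => i.
  by rewrite -val_eqE /= => /negPf ->.
rewrite big1 // => i _; case: eqP => // eq_ik.
by have := ltn_ord i; rewrite eq_ik ltnS leqNgt lt_nk.
Qed.

Lemma coef_qdiff n k :
  (qdiff n)`_k = if (0 < k <= n)%N then 2 * qcoef (n - k) else 0.
Proof.
rewrite coefB coef_shift_qcoef coefC; case: k => [|k] /=.
  by rewrite subn0 mul1r subrr.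
by rewrite subr0.
Qed.

Lemma shift_qcoefS n :
  shift (qcoef n.+1) - (qcoef n.+1)%:P = 'X * (shift (qcoef n) + (qcoef n)%:P).
Proof.
apply/polyP => k; rewrite -/(qdiff _) coef_qdiff coefXM.
case: k => [|k] //=; rewrite coefD coef_shift_qcoef coefC ltnS.
case: k => [|k] /=; rewrite ?leq0n ?subSS ?subn0; first by ring.
by rewrite addr0.
Qed.

Local Notation Qpair := (pair_coef qcoef).

Lemma shift_Qpair r s :
  shift (Qpair r s) = (Qpair r s)%:P
    + (qdiff r * (qcoef s)%:P - (qcoef r)%:P * qdiff s).
Proof.
rewrite !rmorph_pair_coef (pair_coef_shift r s _ _ shift_qcoefS).
- by rewrite /qdiff /=; ring.
- by rewrite qcoef0 rmorph1.
by rewrite qcoef0 rmorph1.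
Qed.

Definition schurQ s : A :=
  list_pf Qpair s + contract qcoef (list_pf Qpair) s.

Lemma shift_schurQ s :
  shift (schurQ s) = (schurQ s)%:P + contract qdiff (fun t => (schurQ t)%:P) s.
Proof.
pose P0 t := list_pf (fun x y => (Qpair x y)%:P) t.
pose q0 n := (qcoef n)%:P.
have schurQC t : (schurQ t)%:P = P0 t + contract q0 P0 t.
  rewrite rmorphD /= rmorph_list_pf rmorph_contract; congr (_ + _).
  by apply: eq_contractr => u _; apply: rmorph_list_pf.
have shift_pf t :
    shift (list_pf Qpair t) = P0 t + contract qdiff (contract q0 P0) t.
  rewrite rmorph_list_pf -list_pf_shift.
  by apply: eq_list_pf => x y; apply: shift_Qpair.
have shift_q x : shift (qcoef x) = q0 x + qdiff x by rewrite addrC subrK.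
rewrite rmorphD /= rmorph_contract shift_pf (eq_contractl _ _ shift_q).
rewrite (eq_contractr _ (H := shift \o _) (fun t _ => shift_pf t)).
rewrite (contractDl q0 qdiff) !contractDr contract_contract.
have -> : contract q0 (contract qdiff (contract q0 P0)) s = 0.
  rewrite contract_anticomm -[RHS]oppr0 -(contract0r qdiff s); congr (- _).
  by apply: eq_contractr => t _; apply: contract_contract.
rewrite schurQC (eq_contractr _ (fun t _ => schurQC t)) contractDr.
by ring.
Qed.

(** * Orthogonality *)

Lemma sum_coef_contract (N : nat) (c : nat -> A) (e : nat -> nat)
    (h : nat -> {poly A}) (H : seq nat -> A) s :
  \sum_(k < N) c k * (contract h (fun t => (H t)%:P) s)`_(e k) =
  contract (fun r => \sum_(k < N) c k * (h r)`_(e k)) H s.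
Proof.
elim: s H => [|x s IHs] H.
  by rewrite /contract /= big1 // => k _; rewrite coef0 mulr0.
rewrite !contract_cons -(IHs (fun t => H (x :: t))) mulr_suml -sumrB.
by apply: eq_bigr => k _; rewrite coefB coefMC mulrBr mulrA.
Qed.

Lemma schurQ_cons N (m : nat) s : all (gtn N) s -> (0 < N)%N ->
  schurQ (m :: s) =
  \sum_(k < N) (-1) ^+ k * qcoef (m + k) * (shift (schurQ s))`_k.
Proof.
move=> /allP lt_sN N_gt0.
pose c k : A := (-1) ^+ k * qcoef (m + k).
have const_part : \sum_(k < N) c k * ((schurQ s)%:P)`_k = qcoef m * schurQ s.
  case: N N_gt0 {lt_sN} => // N _; rewrite big_ord_recl big1 => [|k _].
    by rewrite coefC /c expr0 mul1r addn0 addr0.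
  by rewrite coefC mulr0.
have lin_part r : r \in s ->
    \sum_(k < N) c k * (qdiff r)`_k = Qpair m r - qcoef m * qcoef r.
  move=> /lt_sN /= lt_rN; rewrite /pair_coef addrC addKr.
  transitivity (\sum_(k < r.+1)
      if k == 0%N :> nat then 0 else c k * (2 * qcoef (r - k))).
    rewrite -(sum_ord_trunc (fun k => if k == 0%N then 0
      else c k * (2 * qcoef (r - k))) lt_rN).
    apply: eq_bigr => k _; rewrite coef_qdiff ltnS lt0n.
    by case: eqP; case: leqP => //=; rewrite mulr0.
  rewrite big_ord_recl add0r big_add1 big_mkord mulr_sumr.
  by apply: eq_bigr => k _; rewrite /c; ring.
have schurQ_contract (h : nat -> A) :
    contract h schurQ s = contract h (list_pf Qpair) s
      + contract h (contract qcoef (list_pf Qpair)) s.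
  exact: contractDr.
rewrite shift_schurQ.
under eq_bigr do rewrite coefD mulrDr.
rewrite big_split /= const_part (sum_coef_contract N c id).
rewrite (eq_contract_mem _ lin_part).
have -> : contract (fun r => Qpair m r - qcoef m * qcoef r) schurQ s =
    contract (Qpair m) schurQ s - qcoef m * contract qcoef schurQ s.
  rewrite -mulNr -contractZl -contractDl.
  by apply: eq_contractl => r; rewrite mulNr.
rewrite !schurQ_contract contract_contract {1}/schurQ.
rewrite {1}/schurQ list_pf_cons contract_cons.
rewrite (eq_contractr qcoef (H := fun t => list_pf _ (m :: t))
  (fun t _ => list_pf_cons _ m t)).
by rewrite (contract_anticomm qcoef (Qpair m)); ring.
Qed.

Lemma schurQ_skew N (m : nat) t : all (gtn N) t -> (0 < m)%N ->
  \sum_(k < N) (-1) ^+ k * qcoef k * (shift (schurQ t))`_(m + k) =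
  contract (fun r => (2 * (r == m))%:R) schurQ t.
Proof.
move=> /allP lt_tN m_gt0.
pose c k : A := (-1) ^+ k * qcoef k.
rewrite shift_schurQ.
under eq_bigr do rewrite coefD coefC addn_eq0 -[m == _]negbK -lt0n m_gt0 add0r.
rewrite (sum_coef_contract N c (addn m)); apply: eq_contract_mem => r.
move=> /lt_tN /= lt_rN.
under eq_bigr do rewrite coef_qdiff addn_gt0 m_gt0 /=.
have [lt_rm|le_mr] := ltnP r m.
  rewrite big1 => [|k _]; last by rewrite leqNgt ltn_addr ?mulr0.
  by rewrite ltn_eqF.
rewrite -(subnKC le_mr); set d := (r - m)%N.
have lt_dN : (d < N)%N by apply: leq_ltn_trans lt_rN; apply: leq_subr.
transitivity (2 * \sum_(k < d.+1) (-1) ^+ k * (qcoef k * qcoef (d - k))).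
  rewrite mulr_sumr -(sum_ord_trunc (fun k =>
    2 * ((-1) ^+ k * (qcoef k * qcoef (d - k)))) lt_dN).
  apply: eq_bigr => k _; rewrite leq_add2l ltnS subnDl /c.
  by case: leqP => _; rewrite ?mulr0 //; ring.
have -> : (m + d == m)%N = (d == 0)%N by rewrite -[X in _ == X]addn0 eqn_add2l.
by rewrite qcoef_alternating natrM.
Qed.

Lemma form_signl k f g : form ((-1) ^+ k * f) g = (-1) ^+ k * form f g.
Proof.
rewrite -signr_odd -[in RHS]signr_odd !mulr_sign.
by case: odd; rewrite // -scaleN1r formZl mulN1r.
Qed.

Lemma formBl f1 f2 g : form (f1 - f2) g = form f1 g - form f2 g.
Proof. by rewrite formDl -scaleN1r formZl mulN1r. Qed.

Lemma form_schurQ_cons (m : nat) s t : (0 < m)%N ->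
  form (schurQ (m :: s)) (schurQ t) =
  contract (fun r => (2 * (r == m))%:R) (fun u => form (schurQ u) (schurQ s)) t.
Proof.
move=> m_gt0; pose N := (\max_(x <- s ++ t) x).+1.
have le_N u : {subset u <= s ++ t} -> all (gtn N) u.
  move=> sub_u; apply/allP => x /sub_u x_st.
  by rewrite /= ltnS; apply: (@leq_bigmax_seq _ _ xpredT id).
rewrite (@schurQ_cons N) //; last by apply: le_N => x; rewrite mem_cat => ->.
have -> : form (\sum_(k < N) (-1) ^+ k * qcoef (m + k) * (shift (schurQ s))`_k)
    (schurQ t) =
    form (\sum_(k < N) (-1) ^+ k * qcoef k * (shift (schurQ t))`_(m + k))
      (schurQ s).
  rewrite !form_suml; apply: eq_bigr => k _.
  rewrite -!mulrA !form_signl; congr (_ * _).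
  by rewrite !form_qcoef formC.
rewrite schurQ_skew //; last first.
  by apply: le_N => x; rewrite mem_cat orbC => ->.
move: (schurQ s) => g; elim: t schurQ {le_N N} => [|x t IHt] H.
  by rewrite /contract form0l.
rewrite !contract_cons -(IHt (fun u => H (x :: u))) -form_natl.
by rewrite -formBl.
Qed.

Lemma form_schurQ s t :
    sorted gtn s -> all (ltn 0) s -> sorted gtn t -> all (ltn 0) t ->
  form (schurQ s) (schurQ t) = if s == t then 2 ^+ size s else 0.
Proof.
have schurQ_nil : schurQ [::] = 1 by rewrite /schurQ /contract /= addr0.
elim: s t => [|m s IHs] t.
  move=> _ _ _; case: t => [|x t] /=; first by rewrite schurQ_nil form1.
  by case/andP=> x_gt0 _; rewrite formC form_schurQ_cons.
rewrite [all _ _]/= => sorted_ms /andP[m_gt0 pos_s].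
have gtn_trans : transitive gtn.
  by move=> y x z /= lt_yx lt_zy; apply: ltn_trans lt_yx.
have sorted_s := path_sorted sorted_ms.
rewrite form_schurQ_cons //; case: t => [|x t] //.
rewrite [all _ _]/= => sorted_xt /andP[x_gt0 pos_t].
have sorted_t := path_sorted sorted_xt.
rewrite contract_cons formC IHs // eqseq_cons.
have -> : contract (fun r => (2 * (r == m))%:R)
    (fun u => form (schurQ (x :: u)) (schurQ s)) t = 0.
  rewrite /contract (alt_sum_nth 0%N) big_nat big1 // => j /= lt_jt.
  case: eqP => [def_m|_]; last by rewrite muln0 mul0r mulr0.
  have sub_t := subseq_rem_nth t j.
  have lt_mx : (m < x)%N.
    have := order_path_min gtn_trans sorted_xt => /allP; apply.
    by rewrite -def_m mem_nth.
  rewrite formC IHs //= ?(subseq_path gtn_trans sub_t) ?x_gt0 //; last first.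
    by apply/allP => y /(mem_subseq sub_t) /(allP pos_t).
  case: eqP => [def_s|_]; last by rewrite !mulr0.
  have := order_path_min gtn_trans sorted_ms => /allP/(_ x).
  rewrite {1}def_s mem_head /= => /(_ isT) lt_xm.
  by have := ltn_trans lt_xm lt_mx; rewrite ltnn.
rewrite subr0 [m == x]eq_sym.
case: eqP => [_|_] /=; last by rewrite muln0 mul0r.
by case: eqP => [->|_]; rewrite ?mulr0 // muln1 exprS.
Qed.

Lemma schurQ_coef_sym (T : {lrmorphism A -> A}) (c : nat -> K) N
    (C : strict_partition N -> strict_partition N -> K) :
    (forall n, odd n -> T (p n) = c n *: p n) ->
    (forall la : strict_partition N,
      T (schurQ la) = \sum_(mu : strict_partition N) C la mu *: schurQ mu) ->
  forall la mu : strict_partition N,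
    2 ^+ size mu * C la mu = 2 ^+ size la * C mu la.
Proof.
move=> Tp hC; have orth (la mu : strict_partition N) :
    form (schurQ la) (schurQ mu) = if la == mu then 2 ^+ size la else 0.
  have [/and3P[? ? _] /and3P[? ? _]] := (parts_strict la, parts_strict mu).
  by rewrite form_schurQ.
have formT (la mu : strict_partition N) :
    form (T (schurQ la)) (schurQ mu) = 2 ^+ size mu * C la mu.
  rewrite hC form_suml (bigD1 mu) //= formZl orth eqxx big1 ?addr0 1?mulrC //.
  by move=> nu /negPf ne_nu; rewrite formZl orth ne_nu mulr0.
by move=> la mu; rewrite -!formT (form_adj Tp) formC.
Qed.

End GradedAlgebra.

Lemma malgU_scale (I : choiceType) (R : nzRingType) (c : R) (k : I) :
  << c *g k >> = c *: (<< k >> : {malg R[I]}).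
Proof. by apply/malgP => j; rewrite mcoeffZ !mcoeffU mulrnAr mulr1. Qed.

Lemma malgUU (M : monomType) (R : nzRingType) (k l : M) :
  << mmul k l >> = << k >> * << l >> :> {malg R[M]}.
Proof. by rewrite -[RHS]/(fgmul _ _) fgmulUU mulr1. Qed.

Lemma Gamma_ind (K : fieldType) (Pr : Gamma K -> Prop) :
    Pr 0 -> (forall f g, Pr f -> Pr g -> Pr (f + g)) ->
    (forall c m, Pr (c *: (<< m >> : Gamma K))) ->
  forall f, Pr f.
Proof.
move=> P0 PD PZ f; rewrite (monalgE f); elim/big_ind: _ => // m _.
by rewrite malgU_scale; apply: PZ.
Qed.

Section GammaInstance.
Variable K : fieldType.

Definition Gamma_mon (m : {cmonom nat}) : Gamma K := << m >>.

Definition Gamma_ext (S : nzRingType) (phi : {rmorphism K -> S})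
  (h : {cmonom nat} -> S) : {additive Gamma K -> S} := mmap phi h.

Lemma Gamma_ext_mon (S : nzRingType) (phi : {rmorphism K -> S}) h c m :
  Gamma_ext phi h (c *: Gamma_mon m) = phi c * h m.
Proof. by rewrite /Gamma_mon -malgU_scale /= mmapU. Qed.

Lemma Qfun_schurQ la : [pchar K] =i pred0 -> Qfun K la = schurQ Gamma_mon la.
Proof.
move=> pchar0.
apply: (@pfaffian_pair_coef K (Gamma K) (qcoef Gamma_mon) la pchar0).
exact: (@qcoef0 K (Gamma K) Gamma_mon pchar0).
Qed.

End GammaInstance.

Lemma pchar_Qts : [pchar Qts] =i pred0.
Proof.
apply/pcharf0P => n; rewrite -(rmorph_nat (@tofrac _)) tofrac_eq0.
rewrite -(rmorph_nat polyC) polyC_eq0 -(rmorph_nat polyC) polyC_eq0.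
exact: Num.Theory.pnatr_eq0.
Qed.

Lemma invmx_SPdiag (K : fieldType) N n (e : 'I_n -> strict_partition N)
    (a : K) :
  a != 0 -> invmx (SPdiag e a) = SPdiag e a^-1.
Proof.
move=> a_neq0; have diagV : SPdiag e a *m SPdiag e a^-1 = 1%:M.
  apply/matrixP => i j; rewrite mul_diag_mx !mxE.
  by case: eqP => _; rewrite ?mulr0n ?mulr0 // mulr1n -exprMn divff ?expr1n.
have [unit_a _] := mulmx1_unit diagV.
by rewrite -[RHS]mul1mx -(mulVmx unit_a) -mulmxA diagV mulmx1.
Qed.

Theorem theorem3p5 (N : nat)
    (C : strict_partition N -> strict_partition N -> Qts)
    (hC : forall la : strict_partition N,
      Tts (Qfun Qts la) =
        \sum_(mu : strict_partition N) C la mu *: Qfun Qts mu) :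
  (forall la mu : strict_partition N,
     2 ^+ size mu * C la mu = 2 ^+ size la * C mu la)
  /\
  (forall (n : nat) (e : 'I_n -> strict_partition N), bijective e ->
     let CN := SPmx e C in
     let HN := SPdiag e (2 : Qts) in
     (CN *m HN)^T = CN *m HN
     /\
     (forall (L : fieldType) (iota : {rmorphism Qts -> L}) (sqrt2 : L),
        sqrt2 ^+ 2 = 2 ->
        let HNhalf := SPdiag e sqrt2 in
        let A := invmx HNhalf *m map_mx iota CN *m HNhalf in
        A^T = A)).
Proof.
have hC' (la : strict_partition N) : Tts (schurQ (@Gamma_mon Qts) la) =
    \sum_(mu : strict_partition N) C la mu *: schurQ (@Gamma_mon Qts) mu.
  rewrite -(Qfun_schurQ la pchar_Qts) hC; apply: eq_bigr => mu _.
  by rewrite -(Qfun_schurQ mu pchar_Qts).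
have symC := @schurQ_coef_sym Qts (Gamma Qts) (@Gamma_mon Qts) (@Gamma_ext Qts)
  pchar_Qts erefl (@malgUU _ _) (@Gamma_ind Qts) (@Gamma_ext_mon Qts) Tts _ N C
  Tts_psum hC'.
split=> // n e _ CN HN.
split=> [|L iota sqrt2 sqrt2_2 HNhalf A].
  apply/matrixP => i j.
  by rewrite /CN /HN mxE !mul_mx_diag !mxE mulrC symC mulrC.
have two_neq0 : (2 : Qts) != 0 by rewrite ((pcharf0P Qts).1 pchar_Qts).
have sqrt2_neq0 : sqrt2 != 0.
  apply: contraNneq two_neq0 => sqrt2_0.
  by rewrite -(fmorph_eq0 iota) rmorph_nat -sqrt2_2 sqrt2_0 expr0n.
apply/matrixP => i j; rewrite /A /HNhalf invmx_SPdiag // mxE.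
rewrite !mul_mx_diag !mul_diag_mx !mxE.
have sqrt2X (k : nat) : sqrt2 ^+ k != 0 by rewrite expf_neq0.
apply: (mulfI (sqrt2X (size (e i)))); apply: (mulfI (sqrt2X (size (e j)))).
have := congr1 iota (symC (e i) (e j)).
rewrite !rmorphM !rmorphXn !rmorph_nat -sqrt2_2 -!exprM.
rewrite !mul2n -!addnn !exprD !exprVn.
move: (sqrt2X (size (e i))) (sqrt2X (size (e j))) (iota _) (iota _).
move: (sqrt2 ^+ size (e i)) (sqrt2 ^+ size (e j)).
move=> a b a_neq0 b_neq0 y x eq_xy.
transitivity (a * a * y); first by field.
by rewrite -eq_xy; field.
Qed.
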